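(* Let $B_k(\alpha)$ ($1\le k\le3$) and $D_{k,i}(\beta)$ ($1\le k\le8$, $1\le i\le\lfloor k/3\rfloor$) be the integer sequences defined in the context. Then for every integer $m\ge2$: (a) for every $1\le k\le3$ there is an integer $\alpha\ge1$ with $B_k(2\alpha-1)\equiv0\pmod m$ (that is, $\mu_m(k)=\min\{\alpha\ge1: B_k(2\alpha-1)\equiv0\pmod m\}$ exists); (b) for every $1\le k\le8$ there is an integer $\beta\ge1$ such that $D_{k,i}(2\beta-1)\equiv0\pmod m$ simultaneously for all $1\le i\le\lfloor k/3\rfloor$ (that is, $\nu_m(k)=\min\{\beta\ge1: D_{k,i}(2\beta-1)\equiv0\pmod m \text{ for } 1\le i\le\lfloor k/3\rfloor\}$ exists).
   Context: The sequences $B_k(\alpha)$ ($\alpha\ge0$) satisfy $B_k(\alpha+4)=f(k)B_k(\alpha+2)+g(k)B_k(\alpha)$ for $\alpha\ge0$, where $f(1)=-8,\ g(1)=0$; $f(2)=104,\ g(2)=-2^{14}$; $f(3)=-3520,\ g(3)=-2^{22}$, with initial values $(B_k(0),B_k(1),B_k(2),B_k(3))$: $B_1:(0,0,0,0)$; $B_2:(0,1,-2048,104)$; $B_3:(0,-24,49152,84480)$. The sequences $D_{k,i}(\beta)$ ($\beta\ge0$) satisfy $D_{k,i}(\beta+4)=h(k)D_{k,i}(\beta+2)+r(k)D_{k,i}(\beta)$ for $\beta\ge0$, with the following coefficients and initial values $(D_{k,i}(0),D_{k,i}(1),D_{k,i}(2),D_{k,i}(3))$: $k=3$: $h=-12$,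 $r=-3^7$; $D_{3,1}:(0,1,-243,-12)$. $k=4$: $h=-2\cdot3^2\cdot19$, $r=-3^{10}$; $D_{4,1}:(0,-12,2916,4104)$. $k=5$: $h=2^2\cdot3^3\cdot17$, $r=-3^{13}$; $D_{5,1}:(0,90,-21870,165240)$. $k=6$: $h=-2\cdot3^2\cdot17\cdot23$, $r=-3^{16}$; $D_{6,1}:(0,-486,118098,3420468)$; $D_{6,2}:(0,1,-177147,-7038)$. $k=7$: $h=2^2\cdot3^3\cdot491$, $r=-3^{19}$; $D_{7,1}:(0,1701,-413343,90200628)$; $D_{7,2}:(0,-21,3720087,-1113588)$. $k=8$: $h=-2\cdot3^4\cdot5\cdot359$, $r=-3^{22}$; $D_{8,1}:(0,0,0,0)$; $D_{8,2}:(0,252,-44641044,-73279080)$. For $k=1,2$ there are no sequences $D_{k,i}$ and condition (b) is vacuous. *)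

(* Defs.v *)
From Stdlib Require Import ZArith Lia.

Open Scope Z_scope.

(* The step is 2, so the even and the odd terms evolve independently. *)
Fixpoint rec4 (p q x0 x1 x2 x3 : Z) (n : nat) : Z :=
  match n with
  | 0%nat => x0
  | 1%nat => x1
  | 2%nat => x2
  | 3%nat => x3
  | S (S (S (S n0) as n2)) =>
      p * rec4 p q x0 x1 x2 x3 n2 + q * rec4 p q x0 x1 x2 x3 n0
  end.

Definition f (k : nat) : Z :=
  match k with
  | 1%nat => -8
  | 2%nat => 104
  | 3%nat => -3520
  | _ => 0
  end.

Definition g (k : nat) : Z :=
  match k with
  | 1%nat => 0
  | 2%nat => - 2 ^ 14
  | 3%nat => - 2 ^ 22
  | _ => 0
  end.

(* Only 1 <= k <= 3 is meaningful; the last branch is a default value. *)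
Definition B (k : nat) : nat -> Z :=
  match k with
  | 1%nat => rec4 (f 1) (g 1) 0 0 0 0
  | 2%nat => rec4 (f 2) (g 2) 0 1 (-2048) 104
  | 3%nat => rec4 (f 3) (g 3) 0 (-24) 49152 84480
  | _ => fun _ => 0
  end.

Definition h (k : nat) : Z :=
  match k with
  | 3%nat => -12
  | 4%nat => - (2 * 3 ^ 2 * 19)
  | 5%nat => 2 ^ 2 * 3 ^ 3 * 17
  | 6%nat => - (2 * 3 ^ 2 * 17 * 23)
  | 7%nat => 2 ^ 2 * 3 ^ 3 * 491
  | 8%nat => - (2 * 3 ^ 4 * 5 * 359)
  | _ => 0
  end.

Definition r (k : nat) : Z :=
  match k with
  | 3%nat => - 3 ^ 7
  | 4%nat => - 3 ^ 10
  | 5%nat => - 3 ^ 13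
  | 6%nat => - 3 ^ 16
  | 7%nat => - 3 ^ 19
  | 8%nat => - 3 ^ 22
  | _ => 0
  end.

(* Only 3 <= k <= 8 and 1 <= i <= k / 3 is meaningful; the last branch is a
   default value. *)
Definition D (k i : nat) : nat -> Z :=
  match k, i with
  | 3%nat, 1%nat => rec4 (h 3) (r 3) 0 1 (-243) (-12)
  | 4%nat, 1%nat => rec4 (h 4) (r 4) 0 (-12) 2916 4104
  | 5%nat, 1%nat => rec4 (h 5) (r 5) 0 90 (-21870) 165240
  | 6%nat, 1%nat => rec4 (h 6) (r 6) 0 (-486) 118098 3420468
  | 6%nat, 2%nat => rec4 (h 6) (r 6) 0 1 (-177147) (-7038)
  | 7%nat, 1%nat => rec4 (h 7) (r 7) 0 1701 (-413343) 90200628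
  | 7%nat, 2%nat => rec4 (h 7) (r 7) 0 (-21) 3720087 (-1113588)
  | 8%nat, 1%nat => rec4 (h 8) (r 8) 0 0 0 0
  | 8%nat, 2%nat => rec4 (h 8) (r 8) 0 252 (-44641044) (-73279080)
  | _, _ => fun _ => 0
  end.

Lemma rec4_step (p q x0 x1 x2 x3 : Z) (n : nat) :
  rec4 p q x0 x1 x2 x3 (n + 4) =
  p * rec4 p q x0 x1 x2 x3 (n + 2) + q * rec4 p q x0 x1 x2 x3 n.
Proof.
  replace (n + 4)%nat with (S (S (S (S n)))) by lia.
  replace (n + 2)%nat with (S (S n)) by lia.
  reflexivity.
Qed.

Lemma B_step (k a : nat) : B k (a + 4) = f k * B k (a + 2) + g k * B k a.
Proof.
  destruct k as [|[|[|[|k]]]]; try apply rec4_step; reflexivity.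
Qed.

Lemma D_step (k i b : nat) :
  D k i (b + 4) = h k * D k i (b + 2) + r k * D k i b.
Proof.
  destruct k as [|[|[|[|[|[|[|[|[|k]]]]]]]]];
    destruct i as [|[|[|i]]]; try apply rec4_step; cbn [D]; ring.
Qed.

(* alpha belongs to the set whose minimum is mu_m(k). *)
Definition B_vanishes (m : Z) (k alpha : nat) : Prop :=
  (1 <= alpha)%nat /\ B k (2 * alpha - 1) mod m = 0.

(* beta belongs to the set whose minimum is nu_m(k). *)
Definition D_vanishes (m : Z) (k beta : nat) : Prop :=
  (1 <= beta)%nat /\
  forall i : nat, (1 <= i <= k / 3)%nat -> D k i (2 * beta - 1) mod m = 0.

Definition is_min (P : nat -> Prop) (n : nat) : Prop :=
  P n /\ forall j : nat, P j -> (n <= j)%nat.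

(* Main.v *)
(** In every case the odd-indexed terms are [c * U (j + 1)], where [U] is the
    Lucas sequence [U 0 = 0], [U 1 = 1], [U (n + 2) = p * U (n + 1) + q * U n]
    with [q = - l ^ e] for a prime [l] dividing [p] ([c = 0] in the degenerate
    cases).  Write [m = l ^ a * b] with [b] prime to [l].  Then [l ^ a] divides
    [U n] for all [n >= 2 * a], while modulo [b] the recurrence can be run
    backwards, so two equal pairs of consecutive residues whose indices differ
    by [d] force [b] to divide [U d]; the pigeonhole principle, applied to
    indices that are multiples of a large number, gives such a [d >= 2 * a]. *)

Require Import Defs.
From Stdlib Require Import ZArith.
From Stdlib Require Import Znumtheory Zpow_facts Lia List Classical Wf_nat.

Open Scope Z_scope.

Fixpoint lucas (p q : Z) (n : nat) : Z :=
  match n with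
  | 0%nat => 0
  | 1%nat => 1
  | S (S n0 as n1) => p * lucas p q n1 + q * lucas p q n0
  end.

Lemma lucas_step (p q : Z) (n : nat) :
  lucas p q (S (S n)) = p * lucas p q (S n) + q * lucas p q n.
Proof. reflexivity. Qed.

(** The odd terms obey the Lucas recurrence, and their first two values [c] and [c * p] are [c]
    times the Lucas values at 1 and 2. *)
Lemma rec4_odd (p q x0 c x2 : Z) (n : nat) :
  rec4 p q x0 c x2 (c * p) (2 * n + 1) = c * lucas p q (S n).
Proof.
  (* The recurrence has order two, so the induction carries two consecutive odd terms. *)
  enough (rec4 p q x0 c x2 (c * p) (2 * n + 1) = c * lucas p q (S n) /\
          rec4 p q x0 c x2 (c * p) (2 * n + 3) = c * lucas p q (S (S n)))
    by tauto.
  induction n as [|n [IH1 IH2]].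
  - cbn; lia.
  - split.
    + replace (2 * S n + 1)%nat with (2 * n + 3)%nat by lia. exact IH2.
    + replace (2 * S n + 3)%nat with (2 * n + 1 + 4)%nat by lia.
      rewrite rec4_step.
      replace (2 * n + 1 + 2)%nat with (2 * n + 3)%nat by lia.
      rewrite IH1, IH2, (lucas_step p q (S n)). ring.
Qed.

(** Two steps of the index gain one factor [l], since both coefficients contain it. Quantifying over
    [j] gives the induction hypothesis at both preceding indices. *)
Lemma pow_divide_lucas (l p q : Z) (hp : (l | p)) (hq : (l | q)) (a j : nat) :
  (l ^ Z.of_nat a | lucas p q (2 * a + j)).
Proof.
  revert j. induction a as [|a IH]; intros j.
  - apply Z.divide_1_l.
  - replace (2 * S a + j)%nat with (S (S (2 * a + j))) by lia.
    rewrite lucas_step, Nat2Z.inj_succ, Z.pow_succ_r by lia.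
    pose proof (IH (S j)) as IHS. rewrite Nat.add_succ_r in IHS.
    destruct hp as [p' ->], hq as [q' ->], (IH j) as [u hu], IHS as [v hv].
    rewrite hu, hv. exists (p' * v + q' * u). ring.
Qed.

Lemma lucas_backwards (b p q : Z) (hbq : rel_prime b q) (i d : nat)
  (h0 : (b | lucas p q (i + d) - lucas p q i))
  (h1 : (b | lucas p q (S (i + d)) - lucas p q (S i))) :
  (b | lucas p q d).
Proof.
  induction i as [|i IH].
  - cbn in h0. rewrite Z.sub_0_r in h0. exact h0.
  - apply IH; [|exact h0].
    (* The difference at [i], multiplied by [q], is a combination of the differences at the next two
       indices; [q] then cancels modulo [b]. *)
    apply Gauss with (b := q); [|exact hbq].
    replace (q * (lucas p q (i + d) - lucas p q i)) with
      ((lucas p q (S (S i + d)) - lucas p q (S (S i)))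
       - p * (lucas p q (S i + d) - lucas p q (S i)))
      by (cbn [Nat.add]; rewrite !lucas_step; ring).
    apply Z.divide_sub_r; [exact h1|]. apply Z.divide_mul_r. exact h0.
Qed.

Lemma pigeonhole {A : Type} (s : nat -> A) (l : list A)
  (hs : forall n, In (s n) l) :
  exists i j : nat, (i < j)%nat /\ s i = s j.
Proof.
  apply NNPP. intros H.
  assert (hinj : forall i j, s i = s j -> i = j).
  { intros i j e. destruct (Nat.lt_trichotomy i j) as [c|[c|c]];
      [exfalso; apply H; exists i, j|exact c|exfalso; apply H; exists j, i];
      auto. }
  assert (hle : (length (map s (seq 0 (S (length l)))) <= length l)%nat).
  { apply NoDup_incl_length.
    - apply NoDup_map_NoDup_ForallPairs; [|apply seq_NoDup].
      intros i j _ _. apply hinj.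
    - intros x hx. apply in_map_iff in hx. destruct hx as [n [<- _]].
      apply hs. }
  rewrite length_map, length_seq in hle. lia.
Qed.

Lemma mod_in_range (m x : Z) (hm : 0 < m) :
  In (x mod m) (map Z.of_nat (seq 0 (Z.to_nat m))).
Proof.
  pose proof (Z.mod_pos_bound x m hm).
  apply in_map_iff. exists (Z.to_nat (x mod m)).
  split; [lia|]. apply in_seq. lia.
Qed.

Lemma mod_eq_divide_sub (m x y : Z) (hm : 0 < m) (e : x mod m = y mod m) :
  (m | y - x).
Proof.
  apply Z.mod_divide; [lia|].
  rewrite Zminus_mod, e, Z.sub_diag. apply Z.mod_0_l. lia.
Qed.

Lemma coprime_divide_lucas (b p q : Z) (hb : 0 < b) (hbq : rel_prime b q)
  (N : nat) :
  exists d : nat, (N < d)%nat /\ (b | lucas p q d).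
Proof.
  set (R := map Z.of_nat (seq 0 (Z.to_nat b))).
  (* Sampling at multiples of [S N] makes the distance between two equal pairs a positive multiple
     of [S N], hence larger than [N]. *)
  destruct (pigeonhole
    (fun t => (lucas p q (t * S N) mod b, lucas p q (S (t * S N)) mod b))
    (list_prod R R)) as [i [j [hij e]]].
  - intros t. apply in_prod; apply mod_in_range; exact hb.
  - injection e as e0 e1.
    exists ((j - i) * S N)%nat. split; [nia|].
    apply lucas_backwards with (i := (i * S N)%nat); [exact hbq| |];
      rewrite <- Nat.mul_add_distr_r;
      replace (i + (j - i))%nat with j by lia;
      apply mod_eq_divide_sub; assumption.
Qed.

Lemma split_prime_part (l m : Z) (hl : prime l) (hm : 0 < m) :
  exists (a : nat) (b : Z), m = l ^ Z.of_nat a * b /\ 0 < b /\ rel_prime b l.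
Proof.
  pose proof (prime_ge_2 l hl) as hl2.
  assert (hm0 : 0 <= m) by lia.
  revert hm. pattern m. apply Z_lt_induction; [|exact hm0].
  clear m hm0. intros m IH hm.
  destruct (Zdivide_dec l m) as [[c ->]|hn].
  - assert (hc : 0 < c) by nia.
    destruct (IH c) as [a [b [e [hb hbl]]]]; [nia|exact hc|].
    exists (S a), b. split; [|tauto].
    rewrite Nat2Z.inj_succ, Z.pow_succ_r, e by lia. ring.
  - exists 0%nat, m. split; [symmetry; apply Z.mul_1_l|].
    split; [exact hm|].
    apply rel_prime_sym, prime_rel_prime; assumption.
Qed.

Lemma divide_lucas (l p q e m : Z) (hl : prime l) (hp : (l | p)) (he : 0 < e)
  (hq : q = - l ^ e) (hm : 0 < m) :
  exists n : nat, (m | lucas p q (S n)).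
Proof.
  destruct (split_prime_part l m hl hm) as [a [b [-> [hb hbl]]]].
  (* The bound [2 * a] makes [d] large enough for [pow_divide_lucas], and positive, so that [pred d]
     is a valid witness. *)
  destruct (coprime_divide_lucas b p q hb) with (N := (2 * a)%nat)
    as [d [hd hbd]].
  { subst q. apply rel_prime_sym, Zis_gcd_minus. rewrite Z.opp_involutive.
    apply rel_prime_Zpower_r; [lia|exact hbl]. }
  exists (pred d). rewrite Nat.lt_succ_pred with (z := 0%nat) by lia.
  rewrite Z.mul_comm.
  destruct hbd as [c hc]. rewrite hc, (Z.mul_comm c b).
  apply Z.mul_divide_mono_l.
  (* The Lucas term is [b * c] and is divisible by the power of [l]; that power is prime to [b], so
     it divides [c]. *)
  apply Gauss with (b := b).
  - rewrite Z.mul_comm, <- hc. replace d with (2 * a + (d - 2 * a))%nat by lia.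
    apply pow_divide_lucas; [exact hp|].
    subst q. apply Z.divide_opp_r.
    replace e with (Z.succ (e - 1)) by lia. rewrite Z.pow_succ_r by lia.
    apply Z.divide_factor_l.
  - apply rel_prime_sym, rel_prime_Zpower_r; [lia|exact hbl].
Qed.

(** Well-ordering of the naturals; excluded middle supplies the decidability of [P]. *)
Lemma exists_min (P : nat -> Prop) (hP : exists n, P n) :
  (exists n, P n) /\ (exists n, is_min P n).
Proof.
  split; [exact hP|].
  destruct (dec_inh_nat_subset_has_unique_least_element P
              (fun n => classic (P n)) hP) as [n [hn _]].
  exists n. exact hn.
Qed.

(** Keeping [x3 = c * p] as an equation lets each concrete table of initial values be checked by
    computation. *)
Lemma rec4_odd_mod (m p q x0 c x2 x3 : Z) (n : nat) (hm : 0 < m)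
  (h3 : x3 = c * p) (hn : (m | lucas p q (S n))) :
  rec4 p q x0 c x2 x3 (2 * S n - 1) mod m = 0.
Proof.
  subst x3. replace (2 * S n - 1)%nat with (2 * n + 1)%nat by lia.
  rewrite rec4_odd. apply Z.mod_divide; [lia|].
  apply Z.divide_mul_r. exact hn.
Qed.

Lemma B_vanishes_exists (m : Z) (k : nat) (hm : 0 < m) (hk : (1 <= k <= 3)%nat) :
  exists alpha : nat, B_vanishes m k alpha.
Proof.
  assert (hk' : (k = 1 \/ 2 <= k <= 3)%nat) by lia.
  destruct hk' as [->|hk'].
  (* [g 1 = 0] is not minus a power of 2, but the sequence for [k = 1] starts with zeros. *)
  - exists 1%nat. split; [lia|]. apply Z.mod_0_l. lia.
  - destruct (divide_lucas 2 (f k) (g k)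
                (match k with 2%nat => 14 | _ => 22 end) m prime_2) as [n hn];
      [| | |exact hm|].
    1-3: destruct k as [|[|[|[|k]]]]; try lia; try reflexivity;
      (apply Zmod_divide; [lia|reflexivity]).
    exists (S n). split; [lia|].
    destruct k as [|[|[|[|k]]]]; try lia;
      (apply rec4_odd_mod; [exact hm|reflexivity|exact hn]).
Qed.

Lemma D_vanishes_exists (m : Z) (k : nat) (hm : 0 < m) (hk : (1 <= k <= 8)%nat) :
  exists beta : nat, D_vanishes m k beta.
Proof.
  assert (hk' : (k = 1 \/ k = 2 \/ 3 <= k <= 8)%nat) by lia.
  destruct hk' as [->|[->|hk']].
  (* Here [k / 3 = 0], so no index [i] is in range. *)
  1-2: exists 1%nat; split; [lia|]; cbn; lia.
  (* The exponents 7, 10, ..., 22 in [r k] are [3 * k - 2]. *)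
  destruct (divide_lucas 3 (h k) (r k) (3 * Z.of_nat k - 2) m prime_3)
    as [n hn]; [|lia| |exact hm|].
  1-2: destruct k as [|[|[|[|[|[|[|[|[|k]]]]]]]]]; try lia; try reflexivity;
    (apply Zmod_divide; [lia|reflexivity]).
  (* [n] depends only on [h k] and [r k], so one index serves all [i] at once; the zero sequence for
     [k = 8], [i = 1] is the case [c = 0]. *)
  exists (S n). split; [lia|]. intros i hi.
  destruct k as [|[|[|[|[|[|[|[|[|k]]]]]]]]]; try lia;
    cbn in hi; destruct i as [|[|[|i]]]; try lia;
    (apply rec4_odd_mod; [exact hm|reflexivity|exact hn]).
Qed.

Theorem theorem3p2 (m : Z) (hm : 2 <= m) :
  (forall k : nat, (1 <= k <= 3)%nat ->
     (exists alpha : nat, B_vanishes m k alpha) /\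
     (exists mu : nat, is_min (B_vanishes m k) mu)) /\
  (forall k : nat, (1 <= k <= 8)%nat ->
     (exists beta : nat, D_vanishes m k beta) /\
     (exists nu : nat, is_min (D_vanishes m k) nu)).
Proof.
  split; intros k hk; apply exists_min.
  - apply B_vanishes_exists; [lia|exact hk].
  - apply D_vanishes_exists; [lia|exact hk].
Qed.
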